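(* Let $n\ge 1$. For any switch $X$, the function $\mathcal{SQ}_X$ from diagrams of $n$-strand braids to quivers, $B\mapsto\mathcal{SQ}_X(B)$, is an invariant of braids; that is, if $B$ and $B'$ are $n$-strand braid diagrams related by a finite sequence of braid Reidemeister moves, then $\mathcal{SQ}_X(B)=\mathcal{SQ}_X(B')$.
   Context: A switch is a set $X$ with an invertible map $\rho=(\rho_1,\rho_2):X\times X\to X\times X$ satisfying the set-theoretic Yang-Baxter equation $(\rho\times\mathrm{Id}_X)(\mathrm{Id}_X\times\rho)(\rho\times\mathrm{Id}_X)=(\mathrm{Id}_X\times\rho)(\rho\times\mathrm{Id}_X)(\mathrm{Id}_X\times\rho)$. An $n$-strand braid diagram $B$ is (up to planar isotopy) a word in $\sigma_1^{\pm1},\dots,\sigma_{n-1}^{\pm1}$ read from top to bottom, where $\sigma_i$ denotes a positive crossing of the strands in positions $i,i+1$; planar isotopy allows $\sigma_i^{\pm1}\sigma_j^{\pm1}=\sigma_j^{\pm1}\sigma_i^{\pm1}$ (any signs) for $|i-j|\ge2$. The braid Reidemeister moves are the direct Reidemeister II moves (inserting or deleting $\sigma_i\sigma_i^{-1}$ or $\sigma_i^{-1}\sigma_i$) and the Reidemeister III moves ($\sigma_i\sigma_{i+1}\sigma_i\leftrightarrow\sigma_{i+1}\sigma_i\sigma_{i+1}$ and its variants with other crossing signs). The map $\varphi_B:X^n\to X^n$ sends a vector of colors at the top of $B$ to the vector of colors induced at the bottom: $\varphi_{\sigma_i}$ replaces $(x_i,x_{i+1})$ by $\rho(x_i,x_{i+1})$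 and fixes the other coordinates, $\varphi_{\sigma_i^{-1}}$ does the same with $\rho^{-1}$, and $\varphi_{B_1B_2}=\varphi_{B_2}\circ\varphi_{B_1}$ for the concatenation $B_1B_2$ ($B_1$ on top). The switch braid quiver $\mathcal{SQ}_X(B)$ is the directed graph with vertex set $X^n$ and with a directed edge from $\overline{x}$ to $\overline{y}$ if and only if $\varphi_B(\overline{x})=\overline{y}$. *)

(* Defs.v *)
From mathcomp Require Import all_boot.
From Stdlib Require Import Relations.

Set Implicit Arguments.
Unset Strict Implicit.
Unset Printing Implicit Defensive.

Definition map12 (X : Type) (r : X * X -> X * X) (t : X * X * X) : X * X * X :=
  let: (x, y, z) := t in let: (x', y') := r (x, y) in (x', y', z).

Definition map23 (X : Type) (r : X * X -> X * X) (t : X * X * X) : X * X * X :=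
  let: (x, y, z) := t in let: (y', z') := r (y, z) in (x, y', z').

(* Invertibility is carried as a two-sided inverse, which is unique, rather   *)
(* than as the proposition [bijective rho], so that rho^-1 is a function.     *)
Record switch := Switch {
  switch_sort :> Type;
  rho : switch_sort * switch_sort -> switch_sort * switch_sort;
  rhoV : switch_sort * switch_sort -> switch_sort * switch_sort;
  rhoK : cancel rho rhoV;
  rhoVK : cancel rhoV rho;
  yang_baxter :
    map12 rho \o map23 rho \o map12 rho =1 map23 rho \o map12 rho \o map23 rho
}.

(* (i, true) is a positive crossing and (i, false) a negative one.  The       *)
(* ordinal i is 0-based: it stands for the crossing of the strands in the     *)
(* positions i and i.+1 of 'I_n.                                              *)
Definition crossing (n : nat) : Type := ('I_n.-1 * bool)%type.

(* A word representing a diagram, read from top to bottom.                    *)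
Definition braid_diagram (n : nat) : Type := seq (crossing n).

Inductive planar_isotopy (n : nat) :
    braid_diagram n -> braid_diagram n -> Prop :=
| FarCommute (B1 B2 : braid_diagram n) (i j : 'I_n.-1) (e d : bool) :
    (i.+2 <= j) || (j.+2 <= i) ->
    planar_isotopy (B1 ++ [:: (i, e); (j, d)] ++ B2)
                   (B1 ++ [:: (j, d); (i, e)] ++ B2).

(* In R3 the pairs of strands crossing with signs a, b, c on one side cross   *)
(* in the reverse order on the other side, each keeping its sign.  The side   *)
(* condition leaves the six sign patterns other than +-+ and -+-, for which   *)
(* no strand lies above, or below, the two others.                            *)
Inductive reidemeister_move (n : nat) :
    braid_diagram n -> braid_diagram n -> Prop :=
| R2 (B1 B2 : braid_diagram n) (i : 'I_n.-1) (e : bool) :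
    reidemeister_move (B1 ++ B2) (B1 ++ [:: (i, e); (i, ~~ e)] ++ B2)
| R3 (B1 B2 : braid_diagram n) (i j : 'I_n.-1) (a b c : bool) :
    j = i.+1 :> nat -> (b == a) || (b == c) ->
    reidemeister_move (B1 ++ [:: (i, a); (j, b); (i, c)] ++ B2)
                      (B1 ++ [:: (j, c); (i, b); (j, a)] ++ B2).

(* Words differing by planar isotopies represent the same diagram, so these   *)
(* are allowed between the moves.                                             *)
Definition reidemeister_equiv (n : nat) :
    braid_diagram n -> braid_diagram n -> Prop :=
  clos_refl_sym_trans _
    (fun B B' => planar_isotopy B B' \/ reidemeister_move B B').

Definition coloring (X : Type) (n : nat) : Type := {ffun 'I_n -> X}.

Definition posl (n : nat) (i : 'I_n.-1) : 'I_n := widen_ord (leq_pred n) i.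

Fact posr_subproof (n : nat) (i : 'I_n.-1) : i.+1 < n.
Proof. by rewrite -ltn_predRL. Qed.

Definition posr (n : nat) (i : 'I_n.-1) : 'I_n := Ordinal (posr_subproof i).

Definition phi_crossing (X : switch) (n : nat) (s : crossing n)
    (x : coloring X n) : coloring X n :=
  let: (i, e) := s in
  let: (u, v) := (if e then @rho X else @rhoV X) (x (posl i), x (posr i)) in
  [ffun k => if k == posl i then u else if k == posr i then v else x k].

Definition phi (X : switch) (n : nat) (B : braid_diagram n)
    (x : coloring X n) : coloring X n :=
  foldl (fun y s => phi_crossing s y) x B.

Record quiver := Quiver {
  vertex : Type;
  edge : vertex -> vertex -> Prop
}.

Definition switch_quiver (X : switch) (n : nat) (B : braid_diagram n) : quiver :=
  @Quiver (coloring X n) (fun x y => phi B x = y).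

(* Main.v *)
Require Import Defs.
From mathcomp Require Import all_boot zify.
From Stdlib Require Import FunctionalExtensionality.

Set Implicit Arguments.
Unset Strict Implicit.
Unset Printing Implicit Defensive.

(** The edges of the quiver of [B] are the graph of the map [phi B], so it is
    enough that [phi B] is unchanged by each elementary move; and since [phi]
    turns concatenation into composition, only the crossings that a move
    exchanges matter.

    Planar isotopy: distant crossings act on disjoint pairs of strands, so their
    maps commute ([phi_crossingC]).  Reidemeister II: opposite crossings act by
    inverse maps ([phi_crossingK]).  Reidemeister III: the two crossings touch
    only three strands, and on the triple of colors carried by these they act
    as [map12] and [map23] ([phi_crossing_put3_12], [phi_crossing_put3_23]);
    the move with three positive crossings is then the Yang-Baxter equation
    ([phi_crossing_braid]).  The other sign patterns follow from this one by
    inverting maps, with no further use of the switch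
    ([signed_braid_relation]). *)

(** The mixed versions come from the positive one by moving factors to the
    other side: p q p = q p q gives for instance p^-1 q p = q p q^-1.  In the two
    excluded patterns, + - + and - + -, the relation does not follow. *)
Lemma signed_braid_relation (T : Type) (p q : bool -> T -> T) :
    (forall e, cancel (p e) (p (~~ e))) ->
    (forall e, cancel (q e) (q (~~ e))) ->
    (forall x, p true (q true (p true x)) = q true (p true (q true x))) ->
  forall a b c, (b == a) || (b == c) ->
  forall x, p c (q b (p a x)) = q a (p b (q c x)).
Proof.
move=> pK qK pqp.
have [pKt pKf] : cancel (p true) (p false) /\ cancel (p false) (p true).
  by split; [apply: (pK true) | apply: (pK false)].
have [qKt qKf] : cancel (q true) (q false) /\ cancel (q false) (q true).
  by split; [apply: (qK true) | apply: (qK false)].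
case=> [] [] [] // _ x.
- by apply: (can_inj pKt); rewrite pKf pqp qKf.
- by apply: (can_inj pKt); apply: (can_inj qKt); rewrite pKf qKf -pqp pKf qKf.
- by apply: (can_inj qKt); rewrite qKf -pqp pKf.
- by apply: (can_inj qKt); apply: (can_inj pKt); rewrite qKf pKf pqp qKf pKf.
- apply: (can_inj pKt); apply: (can_inj qKt); apply: (can_inj pKt).
  by rewrite pKf qKf pKf pqp qKf pKf qKf.
Qed.

Lemma posr_eq_posl (n : nat) (i : 'I_n.-1) : (posr i == posl i) = false.
Proof. by rewrite -val_eqE /= gtn_eqF. Qed.

(** The positions of the two strands are distinct, so the colors written by the
    first crossing are the ones read by the second. *)
Lemma phi_crossingK (X : switch) (n : nat) (i : 'I_n.-1) (e : bool) :
  cancel (@phi_crossing X n (i, e)) (@phi_crossing X n (i, ~~ e)).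
Proof.
pose r b : X * X -> X * X := if b then @rho X else @rhoV X.
have rK : cancel (r e) (r (~~ e)) by case: e; [apply: rhoK | apply: rhoVK].
move=> x; rewrite /phi_crossing -/(r e) -/(r (~~ e)).
case E: (r e _) => [u v]; rewrite !ffunE posr_eq_posl !eqxx -E rK.
apply/ffunP=> k; rewrite !ffunE.
by case: eqP => [->|_] //; case: eqP => [->|].
Qed.

(** Neither crossing reads a position that the other one overwrites. *)
Lemma phi_crossingC (X : switch) (n : nat) (i j : 'I_n.-1) (e d : bool)
    (x : coloring X n) :
    (i.+2 <= j) || (j.+2 <= i) ->
  phi_crossing (j, d) (phi_crossing (i, e) x) =
  phi_crossing (i, e) (phi_crossing (j, d) x).
Proof.
move=> far.
have [ll lr rl rr] : [/\ posl i != posl j, posl i != posr j,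
    posr i != posl j & posr i != posr j].
  rewrite -!val_eqE /=.
  by split; lia.
rewrite /phi_crossing.
set r := if e then _ else _; set s := if d then _ else _.
case E: (r _) => [u v]; case F: (s (x _, _)) => [w t].
rewrite !ffunE ![posl j == _]eq_sym ![posr j == _]eq_sym.
rewrite (negbTE ll) (negbTE lr) (negbTE rl) (negbTE rr) E F.
apply/ffunP=> k; rewrite !ffunE.
case: (k =P posl i) => [->|_]; first by rewrite (negbTE ll) (negbTE lr).
by case: (k =P posr i) => [->|_] //; rewrite (negbTE rl) (negbTE rr).
Qed.

(** Recoloring three strands of a fixed background [x]: this isolates the action
    of two adjacent crossings in the triple [t], where the Yang-Baxter equation
    is stated. *)
Definition put3 (X : Type) (n : nat) (l m r : 'I_n) (x : coloring X n)
    (t : X * X * X) : coloring X n :=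
  [ffun k => if k == l then t.1.1 else if k == m then t.1.2
             else if k == r then t.2 else x k].

Lemma put3_id (X : Type) (n : nat) (l m r : 'I_n) (x : coloring X n) :
  put3 l m r x (x l, x m, x r) = x.
Proof.
apply/ffunP=> k; rewrite ffunE /=.
by case: eqP => [->|_] //; case: eqP => [->|_] //; case: eqP => [->|].
Qed.

Lemma phi_crossing_put3_12 (X : switch) (n : nat) (i : 'I_n.-1) (r : 'I_n)
    (x : coloring X n) (t : X * X * X) :
  phi_crossing (i, true) (put3 (posl i) (posr i) r x t) =
  put3 (posl i) (posr i) r x (map12 (@rho X) t).
Proof.
case: t => [[a b] c]; rewrite /phi_crossing !ffunE posr_eq_posl !eqxx /=.
case: (rho _) => u v; apply/ffunP=> k; rewrite !ffunE /=.
by case: eqP => //; case: eqP.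
Qed.

Lemma phi_crossing_put3_23 (X : switch) (n : nat) (l : 'I_n) (j : 'I_n.-1)
    (x : coloring X n) (t : X * X * X) :
    l < j ->
  phi_crossing (j, true) (put3 l (posl j) (posr j) x t) =
  put3 l (posl j) (posr j) x (map23 (@rho X) t).
Proof.
move=> lj.
have Nl : (posl j == l) = false by rewrite -val_eqE /= gtn_eqF.
have Nr : (posr j == l) = false by rewrite -val_eqE /= gtn_eqF // ltnW.
case: t => [[a b] c]; rewrite /phi_crossing !ffunE posr_eq_posl !eqxx Nl Nr /=.
case: (rho _) => u v; apply/ffunP=> k; rewrite !ffunE /=.
case: (k =P posl j) => [->|_]; first by rewrite Nl.
by case: (k =P posr j) => [->|_] //; rewrite Nr.
Qed.

(** Three adjacent strands carry the triple of their own colors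
    ([put3_id]), on which the two sides act by the two sides of the Yang-Baxter
    equation. *)
Lemma phi_crossing_braid (X : switch) (n : nat) (i j : 'I_n.-1)
    (x : coloring X n) :
    j = i.+1 :> nat ->
  phi_crossing (i, true) (phi_crossing (j, true) (phi_crossing (i, true) x)) =
  phi_crossing (j, true) (phi_crossing (i, true) (phi_crossing (j, true) x)).
Proof.
move=> ji; have mid : posr i = posl j by apply: val_inj; rewrite /= ji.
have lj : posl i < j by rewrite ji /=.
have P12 := phi_crossing_put3_12 i (posr j) x; rewrite mid in P12.
have P23 := phi_crossing_put3_23 x _ lj.
rewrite -[x in LHS](put3_id (posl i) (posl j) (posr j)).
rewrite -[x in RHS](put3_id (posl i) (posl j) (posr j)).
by rewrite !(P12, P23); congr put3; apply: yang_baxter.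
Qed.

Lemma phi_cat (X : switch) (n : nat) (B1 B2 : braid_diagram n)
    (x : coloring X n) :
  phi (B1 ++ B2) x = phi B2 (phi B1 x).
Proof. exact: foldl_cat. Qed.

Lemma phi_planar_isotopy (X : switch) (n : nat) (B B' : braid_diagram n) :
  planar_isotopy B B' -> @phi X n B =1 phi B'.
Proof.
case=> B1 B2 i j e d far x; rewrite !phi_cat; congr phi.
exact: phi_crossingC far.
Qed.

Lemma phi_reidemeister_move (X : switch) (n : nat) (B B' : braid_diagram n) :
  reidemeister_move B B' -> @phi X n B =1 phi B'.
Proof.
case=> [B1 B2 i e | B1 B2 i j a b c ji bac] x; rewrite !phi_cat.
  by congr phi; rewrite [RHS]phi_crossingK.
congr phi.
apply: (@signed_braid_relation _ (fun e => @phi_crossing X n (i, e))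
  (fun e => phi_crossing (j, e))) => // [e | e | y].
- exact: phi_crossingK.
- exact: phi_crossingK.
- exact: phi_crossing_braid.
Qed.

Lemma phi_reidemeister_equiv (X : switch) (n : nat) (B B' : braid_diagram n) :
  reidemeister_equiv B B' -> @phi X n B =1 phi B'.
Proof.
elim=> {B B'} [B B' [iso | move] | B | B B' _ IH | B B' B'' _ IH _ IH'] x.
- exact: phi_planar_isotopy.
- exact: phi_reidemeister_move.
- by [].
- by rewrite IH.
- by rewrite IH IH'.
Qed.

Theorem theorem9 (n : nat) (hn : 1 <= n) (X : switch) (B B' : braid_diagram n) :
  reidemeister_equiv B B' -> switch_quiver X B = switch_quiver X B'.
Proof.
move=> /(phi_reidemeister_equiv (X := X)) eq_phi; rewrite /switch_quiver.
by rewrite (functional_extensionality _ _ eq_phi).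
Qed.
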